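(* A probability distribution of probability measures on a measure space $(R,\Sigma)$ is equivalent to a measure on the measure space $(R,\Sigma)$.
   Context: Here $R$ is a set and $\Sigma$ is a sigma-algebra on $R$; the pair $(R,\Sigma)$ is called a measure space (no particular measure on it is fixed). An ordinary (''first-order'') probability measure is a probability measure $\lambda$ on $(R,\Sigma)$. A probability distribution of probability measures on $(R,\Sigma)$ is a ''second-order'' probability measure $\mu(\lambda)$, where $\lambda$ ranges over first-order probability measures on $(R,\Sigma)$. Equivalence is understood in the sense of implying one and the same probability with which $r\in R$ falls within every measurable subset $E$ of $R$ (that is, every $E\in\Sigma$). Under a first-order measure $\nu$ this probability is $\nu(E)$; under the second-order measure $\mu$ it is $\Pr[r\in E]=\int\lambda(E)\,d\mu(\lambda)$, the integral being taken in the Lebesgue sense. *)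

(* Defs.v *)
From HB Require Import structures.
From mathcomp Require Import all_boot all_order all_algebra.
From mathcomp Require Import all_classical all_reals all_analysis measurable_realfun.

Set Implicit Arguments.
Unset Strict Implicit.
Unset Printing Implicit Defensive.

Local Open Scope classical_set_scope.
Local Open Scope ring_scope.
Local Open Scope ereal_scope.

Section second_order_probability.
Context d (T : measurableType d) (R : realType).

(* No particular sigma-algebra on the set of first-order probability measures
   is singled out: G is arbitrary, and <<s G >> = G when G is itself a
   sigma-algebra.  (The library's [pprobability T R] is the case
   G := pset.)  *)
Definition probability_space (G : set (set (probability T R))) :
    measurableType G.-sigma :=
  g_sigma_algebraType G.

(* What the Lebesgue integral of lambda(E) against a second-order measure
   needs in order to make sense for every E. *)
Definition measurable_evaluations (G : set (set (probability T R))) : Prop :=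
  forall E : set T, measurable E ->
    measurable_fun [set: probability_space G]
      (fun lambda : probability_space G => (lambda : probability T R) E : \bar R).

Definition second_order_probability (G : set (set (probability T R)))
    (mu : probability (probability_space G) R) (E : set T) : \bar R :=
  \int[mu]_lambda (lambda : probability T R) E.

Definition equivalent_to_first_order (G : set (set (probability T R)))
    (mu : probability (probability_space G) R) (nu : probability T R) : Prop :=
  forall E : set T, measurable E -> nu E = second_order_probability mu E.

End second_order_probability.

(* Main.v *)
(* The mixture E |-> \int lambda(E) dmu(lambda) is itself the required measure:
   countable additivity is Tonelli's exchange of sum and integral, applied to
   the nonnegative evaluations lambda |-> lambda(F_n). *)
Require Import Defs.
From HB Require Import structures.
From mathcomp Require Import all_boot all_order all_algebra.
From mathcomp Require Import all_classical all_reals all_analysis measurable_realfun.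

Local Open Scope classical_set_scope.

Section second_order_probability_measure.
Local Open Scope ereal_scope.
Context {R : realType} {d : measure_display} {T : measurableType d}.
Context {G : set (set (probability T R))}.
Variable mu : probability (probability_space G) R.

Lemma second_order_probability0 : second_order_probability mu set0 = 0.
Proof. by apply: integral0_eq => l _; rewrite measure0. Qed.

Lemma second_order_probability_ge0 (E : set T) :
  0 <= second_order_probability mu E.
Proof. by apply: integral_ge0 => l _; exact: measure_ge0. Qed.

Lemma second_order_probability_setT :
  second_order_probability mu [set: T] = 1.
Proof.
rewrite /second_order_probability.
rewrite (eq_integral (cst 1)) => [|l _]; last exact: probability_setT.
rewrite integral_cst; last exact: measurableT.
(* What remains is the total mass of [mu] itself; the masses of the first-order measures were
   already replaced by the constant 1. *)
by rewrite mul1e; exact: probability_setT.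
Qed.

Lemma second_order_probability_sigma_additive :
  measurable_evaluations G -> semi_sigma_additive (second_order_probability mu).
Proof.
move=> mG F mF tF mUF.
(* With the limit rewritten as the sum of the series, only convergence of the partial sums is left,
   and this follows from nonnegativity of the terms. *)
have -> : second_order_probability mu (\bigcup_n F n) =
    \sum_(0 <= n <oo) second_order_probability mu (F n).
  rewrite /second_order_probability -integral_nneseries//; last first.
    by move=> n; exact: mG.
  (* The integrands agree pointwise, by countable additivity of each first-order measure [l]. *)
  apply: eq_integral => l _; apply/esym/cvg_lim => //.
  exact: measure_semi_sigma_additive.
apply: is_cvg_nneseries => n _ _; exact: second_order_probability_ge0.
Qed.

End second_order_probability_measure.

Theorem mainTheorem1 (R : realType) (d : measure_display)
    (T : measurableType d) (G : set (set (probability T R)))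
    (mG : measurable_evaluations G)
    (mu : probability (probability_space G) R) :
  exists nu : probability T R, equivalent_to_first_order mu nu.
Proof.
pose m := isMeasure.Build _ T R (second_order_probability mu)
  (second_order_probability0 mu) (second_order_probability_ge0 mu)
  (second_order_probability_sigma_additive mu mG).
pose nu : {measure set T -> \bar R}%R :=
  HB.pack (second_order_probability mu) m.
pose p := Measure_isProbability.Build _ T R nu (second_order_probability_setT mu).
(* The underlying function of [P] is the mixture itself, so the required equality on each [E] holds
   by conversion. *)
pose P : probability T R := HB.pack (second_order_probability mu) m p.
by exists P.
Qed.
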